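(* Fix a real number $\alpha$ with $0<\alpha\leq 1$. A typical continuous function $f\in C[0,1]$ is not H\''older continuous of exponent $\alpha$ on any set of Hausdorff dimension larger than $1-\alpha$. That is, the set of those $f\in C[0,1]$ for which there is no set $H\subset[0,1]$ of Hausdorff dimension larger than $1-\alpha$ such that $f|_H$ is H\''older continuous of exponent $\alpha$ is residual in $C[0,1]$.
   Context: $C[0,1]$ is the Banach space of continuous real-valued functions on $[0,1]$ with the supremum norm. A property holds for a typical continuous function if the set of $f\in C[0,1]$ having the property is residual (comeager), i.e. its complement is of first category in $C[0,1]$. For $H\subset[0,1]$, the restriction $f|_H$ is H\''older continuous of exponent $\alpha$ if there is a constant $K$ such that $|f(x)-f(y)|\leq K|x-y|^\alpha$ for all $x,y\in H$. *)

(* Defs.v *)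
From HB Require Import structures.
From mathcomp Require Import all_boot all_order all_algebra.
From mathcomp Require Import all_classical all_reals all_analysis.
From mathcomp Require Import ring.

Set Implicit Arguments.
Unset Strict Implicit.
Unset Printing Implicit Defensive.

Import Order.TTheory GRing.Theory Num.Theory.
Import numFieldNormedType.Exports.

Local Open Scope classical_set_scope.
Local Open Scope ring_scope.

Definition I01 (R : realType) : Type := set_type (`[0, 1]%classic : set R).

HB.instance Definition _ (R : realType) := PseudoMetric.on (I01 R).

(* An alias of the library's type of continuous functions, so that the
   sup-norm structure declared below is the only topology inferred on it. *)
Definition C01 (R : realType) : Type := continuousType (I01 R) R.

Definition supnorm (R : realType) (f : I01 R -> R) : R :=
  sup (range (fun x => `|f x|)).

Section continuous_operations.
Context {R : realType} {X : topologicalType}.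
Implicit Types f g : X -> R.

Fact zero_cts : continuous (fun _ : X => 0 : R).
Proof. by move=> x; exact: cvg_cst. Qed.

Fact opp_cts f : continuous f -> continuous (fun x => - f x).
Proof. by move=> cf x; apply: cvgN; exact: cf. Qed.

Fact add_cts f g :
  continuous f -> continuous g -> continuous (fun x => f x + g x).
Proof. by move=> cf cg x; apply: cvgD; [exact: cf|exact: cg]. Qed.

Fact scale_cts (a : R) f : continuous f -> continuous (fun x => a * f x).
Proof. by move=> cf x; apply: cvgM; [exact: cvg_cst|exact: cf]. Qed.

Lemma cts_distP f : continuous f <->
  forall x e, 0 < e -> \forall y \near x, `|f x - f y| <= e.
Proof.
split=> [cf x e e0|cf x]; last exact/cvgrPdist_le/cf.
by have /cvgrPdist_le/(_ _ e0) := cf x.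
Qed.

End continuous_operations.

Lemma compact_cts_bounded (R : realType) (A : set R) (f : A -> R) :
  compact A -> continuous f -> exists M, forall x, `|f x| <= M.
Proof.
move=> cA /(@subspace_valL_continuousP' _ _ _ 0) cf.
have /compact_bounded[M [_ +]] := continuous_compact cf cA.
move=> /(_ (M + 1)); rewrite ltrDl ltr01 => /(_ isT) Mf.
exists (M + 1) => x; apply: Mf; exists (val x); first exact/set_mem/valP.
by rewrite -[f in RHS](valLK 0).
Qed.

Section C01_banach.
Context {R : realType}.
Implicit Types f g h : C01 R.

HB.instance Definition _ := Choice.copy (C01 R) (continuousType (I01 R) R).

Lemma C01_continuous f : continuous f.
Proof. exact: cts_fun. Qed.

Lemma C01P f g : (forall x, f x = g x) -> f = g.
Proof. by move=> fg; apply: (proj2 (@continuousEP _ _ f g)). Qed.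

Definition C01_mk (f : I01 R -> R) (cf : continuous f) : C01 R := mkcts cf.

Definition C01_zero := C01_mk zero_cts.
Definition C01_opp f := C01_mk (opp_cts (@C01_continuous f)).
Definition C01_add f g :=
  C01_mk (add_cts (@C01_continuous f) (@C01_continuous g)).
Definition C01_scale (a : R) f :=
  C01_mk (@scale_cts _ _ a _ (@C01_continuous f)).

Fact C01_addA : associative C01_add.
Proof. by move=> f g h; apply: C01P => x; exact: addrA. Qed.
Fact C01_addC : commutative C01_add.
Proof. by move=> f g; apply: C01P => x; exact: addrC. Qed.
Fact C01_add0 : left_id C01_zero C01_add.
Proof. by move=> f; apply: C01P => x; exact: add0r. Qed.
Fact C01_addN : left_inverse C01_zero C01_opp C01_add.
Proof. by move=> f; apply: C01P => x; exact: addNr. Qed.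

HB.instance Definition _ :=
  GRing.isZmodule.Build (C01 R) C01_addA C01_addC C01_add0 C01_addN.

Fact C01_scaleA a b f : C01_scale a (C01_scale b f) = C01_scale (a * b) f.
Proof. by apply: C01P => x; exact: mulrA. Qed.
Fact C01_scale1 : left_id 1 C01_scale.
Proof. by move=> f; apply: C01P => x; exact: mul1r. Qed.
Fact C01_scaleDr : right_distributive C01_scale +%R.
Proof. by move=> a f g; apply: C01P => x; exact: mulrDr. Qed.
Fact C01_scaleDl f : {morph C01_scale^~ f : a b / a + b}.
Proof. by move=> a b; apply: C01P => x; exact: mulrDl. Qed.

HB.instance Definition _ := GRing.Zmodule_isLmodule.Build R (C01 R)
  C01_scaleA C01_scale1 C01_scaleDr C01_scaleDl.

Lemma C01_addE f g x : (f + g) x = f x + g x. Proof. by []. Qed.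
Lemma C01_oppE f x : (- f) x = - f x. Proof. by []. Qed.
Lemma C01_scaleE (a : R) f x : (a *: f) x = a * f x. Proof. by []. Qed.

Definition I01_zero : I01 R.
Proof. by exists 0; rewrite inE /I01 /= in_itv /= lexx ler01. Defined.

Lemma C01_has_sup f : has_sup (range (fun x => `|f x|)).
Proof.
split; first by exists `|f I01_zero|, I01_zero.
have [M fM] := compact_cts_bounded (@segment_compact R 0 1) (@C01_continuous f).
by exists M => _ [x _ <-]; exact: fM.
Qed.

Lemma le_supnorm f x : `|f x| <= supnorm f.
Proof. by apply: ub_le_sup; [exact: (C01_has_sup f).2|exists x]. Qed.

Lemma supnorm_le f (M : R) : (forall x, `|f x| <= M) -> supnorm f <= M.
Proof.
by move=> fM; apply: ge_sup; [exact: (C01_has_sup f).1|move=> _ [x _ <-]].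
Qed.

Fact supnormD f g : supnorm (f + g) <= supnorm f + supnorm g.
Proof.
apply: supnorm_le => x; rewrite C01_addE (le_trans (ler_normD _ _))//.
by rewrite lerD ?le_supnorm.
Qed.

Fact supnormZ (a : R) f : supnorm (a *: f) = `|a| * supnorm f.
Proof.
have leZ (b : R) g : supnorm (b *: g) <= `|b| * supnorm g.
  by apply: supnorm_le => x; rewrite C01_scaleE normrM ler_wpM2l ?le_supnorm.
apply/eqP; rewrite eq_le leZ /=; have [->|a0] := eqVneq a 0.
  rewrite normr0 mul0r.
  exact: le_trans (normr_ge0 _) (le_supnorm _ I01_zero).
rewrite mulrC -ler_pdivlMr ?normr_gt0// mulrC -normfV.
by have := leZ a^-1 (a *: f); rewrite scalerA mulVf// scale1r.
Qed.

Fact supnorm_eq0 f : supnorm f = 0 -> f = 0.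
Proof.
move=> f0; apply: C01P => x; apply/eqP; rewrite -normr_le0 -f0.
exact: le_supnorm.
Qed.

HB.instance Definition _ := Lmodule_isNormed.Build R (C01 R)
  supnormD supnormZ supnorm_eq0.

Lemma C01_normE f : `|f| = supnorm f. Proof. by []. Qed.

Lemma C01_complete (F : set_system (C01 R)) :
  ProperFilter F -> cauchy F -> cvg F.
Proof.
move=> FF /cauchy_ballP Fc.
have cF (x : I01 R) : cauchy ((fun f => f x : R) @ F).
  apply/cauchy_ballP => e e0; rewrite near_map2.
  apply: filterS (Fc e e0) => -[f g] /=.
  by rewrite -!ball_normE /=; exact/le_lt_trans/(le_supnorm (f - g)).
have /choice[l lF] : forall x : I01 R, exists l : R,
  forall e, 0 < e -> \forall f \near F, `|l - (f : C01 R) x| <= e.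
  move=> x.
  have /cvg_ex[l fl] := R_complete (fmap_proper_filter _ FF) (cF x).
  by exists l => e e0; have /cvgrPdist_le/(_ _ e0) := fl.
have Fl (e : R) : 0 < e ->
  \forall f \near F, forall x, `|l x - (f : C01 R) x| <= e.
  move=> e0; have e20 : 0 < e / 2 by rewrite divr_gt0.
  near=> f => x; near F => g.
  rewrite -(subrK (g x) (l x)) -addrA (splitr e).
  rewrite (le_trans (ler_normD _ _))// lerD//.
    by near: g; exact: lF.
  apply: (le_trans (le_supnorm (g - f) x)); apply: ltW.
  rewrite -C01_normE distrC.
  suff: ball f (e / 2) g by rewrite -ball_normE.
  near: g; near: f.
  exact: (nearP_dep (Fc _ e20)).
have cl : continuous l.
  apply/cts_distP => x e e0; have e30 : 0 < e / 3 by rewrite divr_gt0.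
  near F => f.
  have lf : forall x, `|l x - f x| <= e / 3 by near: f; exact: Fl.
  have /cts_distP/(_ x _ e30) := @C01_continuous f.
  apply: filterS => y fxy.
  rewrite (_ : l x - l y = (l x - f x) + (f x - f y) - (l y - f y)); last first.
    by rewrite opprB !subrKA.
  rewrite (le_trans (ler_normB _ _))// (_ : e = e / 3 + e / 3 + e / 3).
    by rewrite lerD// (le_trans (ler_normD _ _))// lerD.
  by field.
apply/cvg_ex; exists (C01_mk cl); apply/cvgrPdist_le => e e0.
by apply: filterS (Fl e e0) => f lf; exact: supnorm_le.
Unshelve. all: by end_near. Qed.

HB.instance Definition _ := Uniform_isComplete.Build (C01 R) C01_complete.

End C01_banach.

Section baire_category.
Context {T : topologicalType}.

Definition nowhere_dense (A : set T) := (closure A)° = set0.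

Definition first_category (A : set T) :=
  exists2 F : (set T)^nat, forall n, nowhere_dense (F n) & A = \bigcup_n F n.

Definition residual (A : set T) := first_category (~` A).

End baire_category.

Section hausdorff_dimension.
Context {R : realType}.
Local Open Scope ereal_scope.
Implicit Types (A : set R) (U : (set R)^nat) (s d : R).

(* The diameter of the empty set is -oo here. *)
Definition diam A : \bar R :=
  ereal_sup [set `|x.1 - x.2|%:E | x in A `*` A].

(* diam(A)^s with the conventions diam(set0)^0 = 0, and diam(A)^0 = 1 for A
   nonempty (the zero-dimensional measure counts points). *)
Definition diam_pow s A : \bar R :=
  if A == set0 then 0 else poweR (diam A) s.

Definition delta_cover d A U :=
  A `<=` \bigcup_i U i /\ forall i, diam (U i) <= d%:E.

Definition hausdorff_content s d A : \bar R :=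
  ereal_inf [set \sum_(i <oo) diam_pow s (U i) | U in delta_cover d A].

Definition hausdorff_measure s A : \bar R :=
  ereal_sup [set hausdorff_content s d A | d in [set d | (0 < d)%R]].

Definition hausdorff_dim A : \bar R :=
  ereal_inf [set s%:E | s in [set s | (0 <= s)%R /\ hausdorff_measure s A = 0]].

End hausdorff_dimension.

Definition holder_on (R : realType) (alpha : R) (H : set R) (f : I01 R -> R) :=
  exists K : R, forall x y : I01 R, H (val x) -> H (val y) ->
    `|f x - f y| <= K * (`|val x - val y| `^ alpha).

(* Main.v *)
Require Import Defs.
From HB Require Import structures.
From mathcomp Require Import all_boot all_order all_algebra.
From mathcomp Require Import all_classical all_reals all_analysis.
From mathcomp Require Import ring lra zify.
Import Order.TTheory GRing.Theory Num.Theory.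
Import numFieldNormedType.Exports.
Local Open Scope classical_set_scope.
Local Open Scope ring_scope.

(** Why the theorem is true.

    Suppose that on an interval of length [2^-n] a function [f0] is steep, with
    slope at least [S], where [S] is of order [2^n], and let [f] be very close
    to [f0].  If [f] is Hoelder of exponent [alpha] and constant [K] on a set
    [H], then two points of [H] in this interval at distance [d] satisfy, up to
    a negligible error, [S d <= K d^alpha], that is [d^(1 - alpha) <= K / S]
    ([steep_holder_dist]).  So the [2^n] intervals cut [H] into pieces of
    diameter at most [r], where [r^(1 - alpha)] is of order [2^-n], and the sum
    of the diameters to the power [1 - alpha + e] is of order [r^e], which is
    as small as desired.  The scales are chosen in [balanced_scales]; fixing
    [r] first, and then [n], treats [alpha = 1] and [alpha < 1] alike.

    Such functions [f0] are dense ([oscillating_near]): a continuous function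
    is uniformly close to a Lipschitz one ([lipschitz_dense]), and adding a
    tooth-shaped wave of small amplitude and huge frequency makes the latter
    steep on every dyadic interval of order [n].  The wave is the [n]-th
    iterate of the tent map, whose slope is [2^n] or [- 2^n] on each of the
    [2^n] dyadic intervals ([iter_tent_expand]).

    Since a whole ball around [f0] inherits the conclusion for the constant
    [K = 1 / e], the functions that have a [1 / e]-Hoelder restriction to a set
    without such an economical cover form a nowhere dense set
    ([nowhere_dense_not_cheap]).  A function outside these sets for
    [e = 1 / (m + 1)] and every [m] is Hoelder of exponent [alpha] only on sets
    of dimension at most [1 - alpha] ([hausdorff_dim_le_of_cheap]). *)

(** * Lipschitz functions are dense in the continuous functions *)

Lemma I01_itv (R : realType) (x : I01 R) : 0 <= val x <= 1.
Proof. by have /set_mem := valP x; rewrite /= in_itv. Qed.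

Lemma ball_I01E (R : realType) (x y : I01 R) (e : R) :
  ball x e y = (`|val x - val y| < e) :> Prop.
Proof. by []. Qed.

Lemma I01_lipschitz_continuous (R : realType) (h : I01 R -> R) (L : R) :
  (forall x y, `|h x - h y| <= L * `|val x - val y|) -> continuous h.
Proof.
move=> hL; apply/cts_distP => x e e0.
have L0 : 0 < `|L| + 1 by rewrite ltr_wpDl.
apply/nbhs_ballP; exists (e / (`|L| + 1)); first by rewrite /= divr_gt0.
move=> y; rewrite ball_I01E => xy; rewrite (le_trans (hL x y))//.
have : `|val x - val y| * (`|L| + 1) < e by rewrite -ltr_pdivlMr.
have := ler_norm L; have := normr_ge0 (val x - val y).
set d := `|_ - _|; nra.
Qed.

(** A uniform modulus of continuity in the form needed by the infimal
    convolution below.  It comes from compactness: near a given point either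
    [y] is close, and continuity bounds the difference by [e], or [y] is at
    distance at least [d / 2], and a large [L] beats the oscillation [2 M]
    of [g]. *)
Lemma C01_linear_modulus (R : realType) (g : C01 R) (e : R) : 0 < e ->
  exists2 L, 0 <= L &
    forall x y : I01 R, g x - g y <= e + L * `|val x - val y|.
Proof.
move=> e0; pose M := supnorm g.
have gM x : `|g x| <= M by exact: le_supnorm.
have M0 : 0 <= M by apply: le_trans (gM (I01_zero)).
pose P (L : R) (t : R) := forall x y : I01 R,
  val x = t -> g x - g y <= e + L * `|t - val y|.
have /compact_near_coveringP/near_covering_withinP cov :=
  @segment_compact R 0 1.
have := cov R (pinfty_nbhs R) P _.
have PF : Filter (pinfty_nbhs R) by typeclasses eauto.
move=> /(_ PF) PL.
have {PL} : \forall L \near +oo, `[0, 1] `<=` P L.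
  apply: PL => t t01.
  pose x0 : I01 R := exist _ t (mem_set t01).
  have e20 : 0 < e / 2 by rewrite divr_gt0.
  have /cts_distP/(_ x0 _ e20) := @C01_continuous R g.
  move=> /nbhs_ballP[d /= d0 dg].
  exists (ball t (d / 2), [set L | 4 * M / d <= L]) => /=.
    split; first by apply: nbhsx_ballx; rewrite divr_gt0.
    by apply: nbhs_pinfty_ge; rewrite num_real.
  move=> [t' L] /= [tt' ML] _ x y xt'.
  have ML' : 4 * M <= L * d by rewrite -ler_pdivrMr.
  have L0 : 0 <= L by rewrite (le_trans _ ML)// divr_ge0 ?mulr_ge0// ltW.
  have := gM x; have := gM y; rewrite !ler_norml => /andP[? ?] /andP[? ?].
  have [near_y|far_y] := ltP `|t' - val y| (d / 2).
    have xx : ball x0 d x.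
      by rewrite ball_I01E xt'; apply: lt_trans tt' _; lra.
    have yy : ball x0 d y.
      rewrite ball_I01E -(subrK t' (val x0)) -addrA.
      rewrite (le_lt_trans (ler_normD _ _))//.
      by rewrite [d in _ < d]splitr ltrD.
    have := dg _ xx; have := dg _ yy; rewrite !ler_norml.
    move=> /andP[? ?] /andP[? ?].
    have : 0 <= L * `|t' - val y| by rewrite mulr_ge0.
    lra.
  have : L * (d / 2) <= L * `|t' - val y| by rewrite ler_wpM2l.
  lra.
move=> PL; near +oo_R => L.
exists L; first by near: L; exact: nbhs_pinfty_ge.
move=> x y; suff : `[0, 1] `<=` P L by apply => //; exact/set_mem/valP.
by near: L.
Unshelve. all: by end_near. Qed.

(** The approximation is the infimal convolution of [g] with [L |x|], an
    infimum of [L]-Lipschitz functions of [x].  It lies below [g] (take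
    [y = x]), and above [g - e] by the linear modulus. *)
Lemma lipschitz_dense (R : realType) (g : C01 R) (e : R) : 0 < e ->
  exists h : I01 R -> R, exists L : R, [/\ 0 <= L,
    forall x y, `|h x - h y| <= L * `|val x - val y| &
    forall x, `|g x - h x| <= e].
Proof.
move=> e0; have [L L0 gL] := C01_linear_modulus R g e e0.
pose A (x : I01 R) := range (fun y : I01 R => g y + L * `|val x - val y|).
have A0 x : A x !=set0 by exists (g x + L * `|val x - val x|), x.
have Alb x : lbound (A x) (g x - e).
  by move=> _ [y _ <-]; have := gL x y; lra.
have Ahlb x : has_lbound (A x) by exists (g x - e).
exists (fun x => inf (A x)), L; split=> //.
- move=> x y; wlog suff : x y / inf (A x) - inf (A y) <= L * `|val x - val y|.
    move=> H; rewrite ler_norml H// andbT.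
    by have := H y x; rewrite distrC; lra.
  rewrite lerBlDl -lerBlDr; apply: lb_le_inf => // _ [z _ <-].
  rewrite lerBlDr; apply: le_trans (ge_inf (Ahlb x) (_ : A x _)) _.
    by exists z.
  rewrite -addrA lerD2l -mulrDr ler_wpM2l// [leRHS]addrC.
   exact: ler_distD.
- move=> x.
  have : inf (A x) <= g x.
    by apply: ge_inf => //; exists x => //; rewrite subrr normr0 mulr0 addr0.
  have := lb_le_inf (A0 x) (Alb x).
  by rewrite ler_norml; lra.
Qed.

(** * Steep oscillating functions *)

Definition tent {R : realType} (x : R) : R := `|2 * x - 1|.

(** The number whose binary digits record on which side of [1 / 2] the
    successive iterates of [x] under the tent map lie: its level sets in [0, 1]
    are the dyadic intervals of order [n], in an order that is not the one of
    the line.  This recursion makes the affinity of the iterates on each level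
    set a plain induction. *)
Fixpoint itinerary {R : realType} (n : nat) (x : R) : nat :=
  if n is m.+1 then ((1 <= 2 * x)%R + 2 * itinerary m (tent x))%N else 0%N.

Lemma itinerary_lt (R : realType) n (x : R) : (itinerary n x < 2 ^ n)%N.
Proof.
elim: n x => [//|n IH] x /=; rewrite expnS.
have := IH (tent x); case: (_ <= _)%R => /=; lia.
Qed.

Lemma iter_tent_itv (R : realType) n (x : R) :
  0 <= x <= 1 -> 0 <= iter n tent x <= 1.
Proof.
move=> x01; elim: n => [//|n /andP[? ?]] /=.
by rewrite /tent normr_ge0 ler_norml; lra.
Qed.

Lemma iter_tent_lipschitz (R : realType) n (x y : R) :
  `|iter n tent x - iter n tent y| <= 2 ^+ n * `|x - y|.
Proof.
elim: n x y => [|n IH] x y; first by rewrite mul1r.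
rewrite !iterSr (le_trans (IH _ _))// exprSr -mulrA ler_pM2l ?exprn_gt0//.
rewrite (le_trans (ler_dist_dist _ _))//.
rewrite (_ : 2 * x - 1 - (2 * y - 1) = 2 * (x - y)); last by ring.
by rewrite normrM ger0_norm.
Qed.

(** Points with the same itinerary always lie on the same branch of the tent
    map, hence each application doubles their distance exactly. *)
Lemma iter_tent_expand (R : realType) n (x y : R) :
  itinerary n x = itinerary n y ->
  `|iter n tent x - iter n tent y| = 2 ^+ n * `|x - y|.
Proof.
elim: n x y => [|n IH] x y; first by rewrite mul1r.
rewrite !iterSr => /= xy.
have {xy}[xy1 xy2] : (1 <= 2 * x) = (1 <= 2 * y) /\
    itinerary n (tent x) = itinerary n (tent y).
  by move: xy; case: (1 <= 2 * x); case: (1 <= 2 * y) => /=; lia.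
rewrite IH// exprSr -mulrA; congr (_ * _).
have -> : 2 * `|x - y| = `|2 * x - 2 * y| by rewrite -mulrBr normrM ger0_norm.
rewrite /tent; have [x1|x1] := leP 1 (2 * x).
  rewrite x1 in xy1; rewrite !(ger0_norm (_ : 0 <= 2 * _ - 1)) ?subr_ge0//.
  by rewrite opprB addrA subrK.
have y1 : 2 * y < 1 by rewrite ltNge -xy1 -ltNge.
rewrite !(@ltr0_norm _ (2 * _ - 1)) ?subr_lt0// distrC.
by rewrite !opprB addrC subrKA.
Qed.

Lemma pow2_bracket (R : realType) (x : R) : 1 <= x ->
  exists n, x <= 2 ^+ n <= 2 * x.
Proof.
move=> x1; have xP : exists n, x <= 2 ^+ n.
  by exists (Num.bound x); rewrite ltW// upper_nthrootP.
case: (ex_minnP xP) => -[|n] xn minn.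
  by exists 0%N; rewrite xn expr0; lra.
exists n.+1; rewrite xn /= exprS ler_pM2l// leNgt; apply/negP => /ltW/minn.
by rewrite ltnn.
Qed.

(** * Choice of the scales *)

(** The two requirements pull the number [2^n] of intervals in opposite
    directions: few intervals make the cover by sets of diameter [r] cheap,
    many make the wave steep compared with the Hoelder condition at scale [r].
    Taking [2^n] equal to [M / r^s] up to a factor [2], with a constant [M]
    that depends neither on [r] nor on [n], the second requirement always
    holds and the first one reads [2 M r^e <= e]. *)
Lemma balanced_scales (R : realType) (s e K L eta : R) :
  0 <= s -> 0 < e -> 0 <= K -> 0 <= L -> 0 < eta ->
  exists n r, [/\ 0 < r <= e, (2 ^+ n)%:R * r `^ (s + e) <= e &
    2 * K <= (eta * 2 ^+ n - L) * r `^ s].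
Proof.
move=> s0 e0 K0 L0 eta0.
(* With this [M], [eta * M - L >= 2 * K]; it is at least [1], so that a power
   of [2] can be found just above [M / r^s]. *)
pose M := 1 + (2 * K + L) / eta.
have M1 : 1 <= M by rewrite lerDl divr_ge0 ?addr_ge0 ?mulr_ge0// ltW.
have M0 : 0 < M := lt_le_trans ltr01 M1.
have eM : 2 * K + L <= eta * M.
  by rewrite /M mulrDr mulr1 (mulrC eta (_ / _)) divfK ?gt_eqF//; lra.
(* The solution of [2 * M * c^e = e]. *)
pose c := (e / (2 * M)) `^ e^-1.
have eM0 : 0 < e / (2 * M) by rewrite divr_gt0// mulr_gt0.
pose r := Order.min (Order.min e 1) c.
have r0 : 0 < r by rewrite !lt_min e0 ltr01 powR_gt0.
have re : r <= e by rewrite !ge_min lexx.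
have r1 : r <= 1 by rewrite !ge_min lexx orbT.
have rc : r <= c by rewrite ge_min lexx orbT.
have q0 : 0 < r `^ s := powR_gt0 s r0.
have q1 : r `^ s <= 1 by rewrite -(powRr0 r) ger_powR// r0.
have [|n /andP[Mn nM]] := @pow2_bracket R (M / r `^ s).
  by rewrite ler_pdivlMr// mul1r (le_trans q1).
exists n, r; rewrite r0 re; split=> //.
  rewrite natrX powRD; last by apply/implyP => _; rewrite gt_eqF.
  have rce : r `^ e <= e / (2 * M).
    have <- : c `^ e = e / (2 * M).
      by rewrite -powRrM mulVf ?gt_eqF// powRr1// ltW.
    by apply: ge0_ler_powR; rewrite ?nnegrE ?powR_ge0 ?(ltW e0) ?(ltW r0).
  rewrite mulrA; apply: (@le_trans _ _ (2 * M * (e / (2 * M)))); last first.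
    by rewrite mulrC divfK// gt_eqF// mulr_gt0.
  rewrite ler_pM ?mulr_ge0 ?exprn_ge0 ?powR_ge0//.
  by rewrite -ler_pdivlMr// -mulrA.
have : M <= 2 ^+ n * r `^ s by rewrite -ler_pdivrMr.
rewrite mulrBl -mulrA => Mq.
have : eta * M <= eta * (2 ^+ n * r `^ s) by rewrite ler_pM2l.
have : L * r `^ s <= L by rewrite ler_piMr.
lra.
Qed.

(** Here [v] is the variation of the perturbed function between two points at
    distance [d], and [K * r^alpha] bounds the effect of the perturbation.
    Writing [d] as [d^(1 - alpha) * d^alpha], a distance [d > r] would give
    [S * d >= 2 * K * d^alpha], more than the Hoelder condition and the
    perturbation allow together. *)
Lemma steep_holder_dist (R : realType) (alpha K S r d v : R) :
  0 < alpha -> alpha <= 1 -> 0 < K -> 0 < r ->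
  2 * K <= S * r `^ (1 - alpha) ->
  S * d <= v + K * r `^ alpha -> v <= K * d `^ alpha -> d <= r.
Proof.
move=> a0 a1 K0 r0 KS Sd vd; rewrite leNgt; apply/negP => rd.
have dpos : 0 < d := lt_trans r0 rd.
have S0 : 0 < S.
  rewrite -(pmulr_lgt0 _ (powR_gt0 (1 - alpha) r0)).
  by rewrite (lt_le_trans _ KS)// mulr_gt0.
have rd1 : r `^ alpha < d `^ alpha.
  by apply: gt0_ltr_powR; rewrite ?nnegrE ?(ltW r0) ?(ltW dpos).
have rd2 : r `^ (1 - alpha) <= d `^ (1 - alpha).
  by apply: ge0_ler_powR; rewrite ?subr_ge0 ?nnegrE ?(ltW r0) ?(ltW rd) ?(ltW dpos).
have dE : d = d `^ (1 - alpha) * d `^ alpha.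
  rewrite -powRD; last by apply/implyP => _; rewrite gt_eqF.
  by rewrite subrK powRr1// ltW.
have dS : 2 * K <= S * d `^ (1 - alpha) by rewrite (le_trans KS)// ler_pM2l.
have : 2 * K * d `^ alpha <= S * d.
  by rewrite {2}dE mulrA ler_wpM2r// powR_ge0.
have : K * r `^ alpha < K * d `^ alpha by rewrite ltr_pM2l.
lra.
Qed.

(** * Nowhere dense sets of functions *)

Definition cheaply_covered {R : realType} (s e : R) (H : set R) :=
  exists (N : nat) (r : R) (U : nat -> set R),
  [/\ 0 < r <= e, N%:R * r `^ (s + e) <= e,
      forall x, H x -> exists2 i, (i < N)%N & U i x &
      forall i x y, U i x -> U i y -> `|x - y| <= r].

(** One parameter [e] plays all the roles at once (fineness and total size of
    the cover, excess of the exponent, inverse of the Hoelder constant), so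
    that a single sequence of values of [e] tending to [0] suffices. *)
Definition cheap_holder_sets {R : realType} (alpha e : R) : set (C01 R) :=
  [set f | forall H : set R, H `<=` `[0, 1] ->
    (forall x y : I01 R, H (val x) -> H (val y) ->
      `|f x - f y| <= e^-1 * `|val x - val y| `^ alpha) ->
    cheaply_covered (1 - alpha) e H].

(** The function [f0] is a Lipschitz approximation [h] of [g] plus a wave of
    amplitude [d / 4]; between points with the same itinerary it has slope at
    least [d / 4 * 2^n - L], where [L] is the Lipschitz constant of [h]. *)
Lemma oscillating_near (R : realType) (alpha e d : R) (g : C01 R) :
  0 < alpha -> alpha <= 1 -> 0 < e -> 0 < d ->
  exists2 f0 : C01 R, `|g - f0| < d & exists2 rho, 0 < rho &
    forall f : C01 R, `|f0 - f| < rho -> cheap_holder_sets alpha e f.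
Proof.
move=> a0 a1 e0 d0.
have d40 : 0 < d / 4 by lra.
have [h [L [L0 hL gh]]] := lipschitz_dense R g _ d40.
have K0 : 0 < e^-1 by rewrite invr_gt0.
have s0 : 0 <= 1 - alpha by rewrite subr_ge0.
have [n [r [/andP[r0 re] Nr Kr]]] :=
  balanced_scales R _ _ _ _ _ s0 e0 (ltW K0) L0 d40.
pose F (x : I01 R) := h x + d / 4 * iter n tent (val x).
have FL (x y : I01 R) : `|F x - F y| <= (L + d / 4 * 2 ^+ n) * `|val x - val y|.
  rewrite /F opprD addrACA -mulrBr mulrDl (le_trans (ler_normD _ _))// lerD//.
  rewrite normrM (gtr0_norm d40) -mulrA ler_pM2l//.
  exact: iter_tent_lipschitz.
pose f0 : C01 R := C01_mk (I01_lipschitz_continuous R F _ FL).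
exists f0.
  apply: (@le_lt_trans _ _ (d / 2)); last by lra.
  rewrite C01_normE; apply: supnorm_le => x.
  have -> : (g - f0) x =
    (g x - h x) - d / 4 * iter n tent (val x).
    by rewrite C01_addE C01_oppE /= /F opprD addrA.
  have := gh x; have /andP[? ?] := iter_tent_itv R n _ (I01_itv R x).
  rewrite !ler_norml => /andP[? ?].
  have : 0 <= d / 4 * iter n tent (val x) by rewrite mulr_ge0// ltW.
  have : d / 4 * iter n tent (val x) <= d / 4 by rewrite ler_piMr// ltW.
  lra.
(* Half of the error allowed by [steep_holder_dist]: the perturbation acts at
   both points. *)
exists (e^-1 * r `^ alpha / 2).
  by rewrite divr_gt0// mulr_gt0// powR_gt0.
move=> f fF H H01 fH.
exists (2 ^ n)%N, r, (fun i => H `&` [set x | itinerary n x = i]).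
split; [by rewrite r0|by rewrite natrX in Nr *| |].
  by move=> x Hx; exists (itinerary n x) => //; exact: itinerary_lt.
move=> i x y [Hx xi] [Hy yi].
pose x' : I01 R := exist _ x (mem_set (H01 _ Hx)).
pose y' : I01 R := exist _ y (mem_set (H01 _ Hy)).
apply: (@steep_holder_dist R alpha e^-1 (d / 4 * 2 ^+ n - L) r _ `|f x' - f y'|)
  => //; last exact: (fH x' y').
have FE : `|F x' - F y'| <= `|f x' - f y'| + e^-1 * r `^ alpha.
  have fr z : `|F z - f z| <= e^-1 * r `^ alpha / 2.
    apply: le_trans (ltW fF); rewrite C01_normE.
    exact: (le_supnorm (f0 - f) z).
  have := fr x'; have := fr y'; rewrite !ler_norml => /andP[? ?] /andP[? ?].
  have := ler_norm (f x' - f y').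
  by have := lerNnormlW (lexx `|f x' - f y'|); lra.
apply: le_trans FE.
have := iter_tent_expand R n x y; rewrite xi yi => /(_ erefl) Exy.
have -> : F x' - F y' =
    d / 4 * (iter n tent x - iter n tent y) - (h y' - h x').
  by rewrite /F/=; ring.
apply: le_trans (lerB_dist _ _).
rewrite normrM (gtr0_norm d40) Exy mulrBl mulrA lerD2l lerN2.
by rewrite distrC; exact: (hL x' y').
Qed.

Lemma nowhere_dense_not_cheap (R : realType) (alpha e : R) (B : set (C01 R)) :
  0 < alpha -> alpha <= 1 -> 0 < e -> B `<=` ~` cheap_holder_sets alpha e ->
  nowhere_dense B.
Proof.
move=> a0 a1 e0 BG; apply/seteqP; split => // g /nbhs_ballP[d /= d0 gB].
have [f0 gf0 [rho rho0 f0G]] := oscillating_near R alpha e d g a0 a1 e0 d0.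
have : closure B f0 by apply: gB; rewrite -ball_normE.
move=> /(_ (ball f0 rho) (nbhsx_ballx _ _ rho0))[f [/BG fG]].
by rewrite -ball_normE => /f0G.
Qed.

(** * Covers and Hausdorff dimension *)

Local Open Scope ereal_scope.

Lemma diam_le (R : realType) (A : set R) (r : R) :
  (forall x y, A x -> A y -> (`|x - y| <= r)%R) -> diam A <= r%:E.
Proof.
move=> Ar; apply: ge_ereal_sup => _ [[x y] [/= Ax Ay] <-].
by rewrite lee_fin Ar.
Qed.

Lemma diam_ge0 (R : realType) (A : set R) : A !=set0 -> 0 <= diam A.
Proof.
move=> [x Ax]; apply: ereal_sup_ubound.
by exists (x, x) => //=; rewrite subrr normr0.
Qed.

Lemma diam_pow_ge0 (R : realType) (t : R) (A : set R) : 0 <= diam_pow t A.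
Proof. by rewrite /diam_pow; case: ifPn => // _; exact: poweR_ge0. Qed.

Lemma diam_pow_le (R : realType) (t r : R) (A : set R) :
  (0 <= t)%R -> (forall x y, A x -> A y -> (`|x - y| <= r)%R) ->
  diam_pow t A <= (r `^ t)%:E.
Proof.
move=> t0 Ar; rewrite /diam_pow; case: ifPn => [_|/set0P A0].
  by rewrite lee_fin powR_ge0.
have := diam_ge0 R A A0 => d0.
have dr := diam_le R A r Ar.
rewrite -poweR_EFin gt0_ler_poweR// in_itv/= leey andbT//.
exact: le_trans d0 dr.
Qed.

Lemma hausdorff_content_ge0 (R : realType) (t d : R) (H : set R) :
  0 <= hausdorff_content t d H.
Proof.
apply: le_ereal_inf_tmp => _ [U _ <-].
by apply: nneseries_ge0 => i _ _; exact: diam_pow_ge0.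
Qed.

(** The finite cover is completed by empty sets, which cost nothing. *)
Lemma hausdorff_content_le (R : realType) (t r d : R) (H : set R) (N : nat)
    (U : nat -> set R) : (0 <= t)%R -> (r <= d)%R ->
  (forall x, H x -> exists2 i, (i < N)%N & U i x) ->
  (forall i x y, U i x -> U i y -> (`|x - y| <= r)%R) ->
  hausdorff_content t d H <= (N%:R * r `^ t)%:E.
Proof.
move=> t0 rd HU Ur; pose V i := if (i < N)%N then U i else set0.
have VU i x : V i x -> U i x by rewrite /V; case: ifP.
have Vr i x y : V i x -> V i y -> (`|x - y| <= r)%R.
  by move=> /VU + /VU; exact: Ur.
apply: (@le_trans _ _ (\sum_(i <oo) diam_pow t (V i))).
  apply: ereal_inf_lbound; exists V => //; split.
    by move=> x /HU[i iN Uix]; exists i => //; rewrite /V iN.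
  by move=> i; apply: le_trans (diam_le _ _ r _) _; [exact: Vr|rewrite lee_fin].
rewrite (nneseries_split 0 N) => [|i _]; last exact: diam_pow_ge0.
rewrite [X in _ + X]eseries0 ?adde0; last first.
  by move=> i; rewrite add0n /V => iN _; rewrite ltnNge iN /diam_pow eqxx.
rewrite add0n big_mkord; apply: (@le_trans _ _ (\sum_(i < N) (r `^ t)%:E)).
  by apply: lee_sum => i _; exact: (@diam_pow_le R t r _ t0 (@Vr i)).
by rewrite sumEFin sumr_const card_ord mulr_natl.
Qed.

(** Given an exponent [s + p] and a scale [d], a cheap cover with parameter
    [e] at most [p] and [d] is admissible, and its cost for [s + p] is at
    most its cost for [s + e], since its sets have diameter at most [1]. *)
Lemma hausdorff_dim_le_of_cheap (R : realType) (s : R) (H : set R) :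
  (0 <= s)%R ->
  (forall e0 : R, (0 < e0)%R ->
    exists e : R, (0 < e <= e0)%R /\ cheaply_covered s e H) ->
  hausdorff_dim H <= s%:E.
Proof.
move=> s0 cheap; apply/lee_addgt0Pr => p p0.
apply: ereal_inf_lbound; exists (s + p)%R => //.
have sp0 : (0 <= s + p)%R by rewrite addr_ge0// ltW.
split=> //; apply/eqP; rewrite eq_le; apply/andP; split; last first.
  apply: le_trans (hausdorff_content_ge0 R (s + p) 1 H) _.
  by apply: ereal_sup_ubound; exists 1%R => //=.
apply: ge_ereal_sup => _ [d /= d0 <-].
apply/lee_addgt0Pr => eps eps0; rewrite add0e.
pose e0 := Order.min (Order.min p d) (Order.min eps 1%R).
have e00 : (0 < e0)%R by rewrite !lt_min p0 d0 eps0 ltr01.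
have [e [/andP[e_gt0 ee0] [N [r [U [/andP[r0 re] Nr HU Ur]]]]]] := cheap _ e00.
move: ee0; rewrite !le_min => /andP[/andP[ep ed] /andP[eeps e1]].
apply: le_trans (hausdorff_content_le _ _ r _ _ N U sp0 _ HU Ur) _.
  exact: le_trans re ed.
rewrite lee_fin (le_trans _ eeps)// (le_trans _ Nr)// ler_wpM2l//.
by rewrite ger_powR ?lerD2l// r0 (le_trans re).
Qed.

Local Close Scope ereal_scope.

(** * Typical functions *)

Theorem theorem0p4 (R : realType) (alpha : R) (alpha_gt0 : 0 < alpha)
    (alpha_le1 : alpha <= 1) :
  residual [set f : C01 R | ~ exists H : set R,
    [/\ H `<=` `[0, 1],
        ((1 - alpha)%:E < hausdorff_dim H)%E
      & holder_on alpha H f]].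
Proof.
set A := [set f | _]; pose e m : R := m.+1%:R^-1.
have e0 m : 0 < e m by rewrite invr_gt0 ltr0n.
exists (fun m => ~` A `&` ~` cheap_holder_sets alpha (e m)).
  by move=> m; apply: (nowhere_dense_not_cheap R alpha (e m)).
rewrite -setI_bigcupr setIidl// => f /contrapT[H [H01 dimH [K fH]]].
apply: contrapT => fcheap.
have {}fcheap m : cheap_holder_sets alpha (e m) f.
  by apply: contrapT => fm; apply: fcheap; exists m.
move: dimH; rewrite ltNge => /negP; apply.
apply: hausdorff_dim_le_of_cheap; first by rewrite subr_ge0.
(* Large enough for [e m <= q] and [K <= m + 1] at once. *)
move=> q q0; pose m := Num.bound (`|K| + q^-1).
have mK : `|K| + q^-1 < m.+1%:R.
  apply: lt_trans (archi_boundP _) _; last by rewrite ltr_nat.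
  by rewrite addr_ge0// invr_ge0 ltW.
exists (e m); split.
  rewrite e0 /e /= invf_ple ?posrE ?ltr0n//.
  by rewrite (le_trans _ (ltW mK))// ler_wpDl.
apply: fcheap => // x y Hx Hy; apply: le_trans (fH x y Hx Hy) _.
rewrite ler_wpM2r ?powR_ge0// /e invrK (le_trans (ler_norm K))//.
by rewrite (le_trans _ (ltW mK))// ler_wpDr// invr_ge0 ltW.
Qed.
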